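(* Fix an integer $m\geq 2$. Let $\Gamma$ be a distance-regular graph with diameter $D\ge 2$ whose smallest eigenvalue $\theta_D$ satisfies $-m\leq \theta_D<1-m$. If the intersection numbers $a_1$ and $c_2$ satisfy $a_1>m^2c_2$, then $\Gamma$ is geometric and $\theta_D=-m$.
   Context: A finite connected graph $\Gamma$ with diameter $D$ is distance-regular if there are integers $b_i,c_i$ ($0\le i\le D$) such that for any vertices $x,y$ with $d(x,y)=i$, exactly $c_i$ neighbours of $y$ are at distance $i-1$ from $x$ and exactly $b_i$ neighbours of $y$ are at distance $i+1$ from $x$; its valency is $k=b_0$ and $a_i:=k-b_i-c_i$. The smallest eigenvalue $\theta_D$ is that of the adjacency matrix. A Delsarte clique is a clique with exactly $1+\frac{k}{-\theta_D}$ vertices. A non-complete distance-regular graph is geometric if there is a set $\mathcal C$ of Delsarte cliques such that every edge lies in exactly one member of $\mathcal C$. *)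

(* Defs.v *)
From HB Require Import structures.
From mathcomp Require Import all_boot all_order all_algebra.
From mathcomp Require Import reals.
Set Implicit Arguments. Unset Strict Implicit. Unset Printing Implicit Defensive.
Import Order.TTheory GRing.Theory Num.Theory.
Local Open Scope ring_scope.

Definition simple_graph (T : finType) (e : rel T) : Prop :=
  symmetric e /\ irreflexive e.

Section Graph.
Variables (T : finType) (e : rel T).

Definition nbhd (A : {set T}) : {set T} :=
  A :|: [set y | [exists z in A, e z y]].

Definition ball (x : T) (n : nat) : {set T} := iter n nbhd [set x].

(* graph distance d(x,y): least n with y in ball x n
   (equals #|T| if no such n <= #|T|-1, which cannot happen when connected) *)
Definition dist (x y : T) : nat :=
  find (fun n => y \in ball x n) (iota 0 #|T|).

Definition connected : Prop := forall x y : T, y \in ball x #|T|.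

Definition diameter : nat := \max_(x : T) \max_(y : T) dist x y.

Definition distance_regular (b c : nat -> nat) : Prop :=
  [/\ simple_graph e, connected &
   forall x y : T,
     #|[set z | e y z & dist x z == (dist x y).-1]| = c (dist x y) /\
     #|[set z | e y z & dist x z == (dist x y).+1]| = b (dist x y)].

Definition complete_graph : Prop := forall x y : T, x != y -> e x y.

Definition clique (C : {set T}) : Prop :=
  forall x y, x \in C -> y \in C -> x != y -> e x y.

Variable R : realType.

Definition adjmx : 'M[R]_#|T| :=
  \matrix_(i, j) (e (enum_val i) (enum_val j))%:R.

Definition smallest_eigenvalue (theta : R) : Prop :=
  eigenvalue adjmx theta /\ (forall mu : R, eigenvalue adjmx mu -> theta <= mu).

Definition delsarte_clique (k : nat) (theta : R) (C : {set T}) : Prop :=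
  clique C /\ (#|C|%:R = 1 + k%:R / (- theta) :> R).

Definition geometric (k : nat) (theta : R) : Prop :=
  ~ complete_graph /\
  exists CC : {set {set T}},
    (forall C, C \in CC -> delsarte_clique k theta C) /\
    (forall x y, e x y -> exists! C, C \in CC /\ x \in C /\ y \in C).

End Graph.

(* Main.v *)
(* Write k, a_1, c_2 for the parameters of the graph and A for its adjacency
   matrix.  As A - theta is positive semidefinite and -m <= theta, testing it on
   a vertex and its neighbourhood gives k <= m (a_1 + m).  With a_1 > m^2 c_2
   this is exactly what Metsch's argument needs: calling "lines" the maximal
   cliques with at least a_1 + 2 - (m - 1)(c_2 - 1) vertices, every edge lies on
   a unique line and every vertex on at most m lines.  The Delsarte bound
   |L| - 1 <= k / -theta and theta < 1 - m force at least m lines, hence exactly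
   m lines, on every vertex.  Lines have more than m vertices, so there are
   fewer lines than vertices and the incidence matrix N, which satisfies
   N N^T = A + m, has a left kernel: -m is an eigenvalue, whence theta = -m.
   Finally the m lines on a vertex partition its k neighbours, so that equality
   holds in the Delsarte bound for each of them. *)
Require Import Defs.
From HB Require Import structures.
From mathcomp Require Import all_boot all_order all_algebra.
From mathcomp Require Import reals complex zify ring lra.
Set Implicit Arguments. Unset Strict Implicit. Unset Printing Implicit Defensive.
Import Order.TTheory GRing.Theory Num.Theory.

(** * Bounds on unions of finite sets *)

Lemma card_bigcup_le (I : eqType) (T : finType) (K : I -> {set T}) (l : seq I) nu :
  {in l, forall i, #|K i| <= nu} -> #|\bigcup_(i <- l) K i| <= size l * nu.
Proof.
elim: l => [|i l IH] hK; first by rewrite big_nil cards0.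
rewrite big_cons mulSn (leq_trans (leq_card_setU _ _)) // leq_add ?hK ?mem_head //.
by apply: IH => j jl; rewrite hK // in_cons jl orbT.
Qed.

(** Induction on [l]: one more set meets the union of the others in at most [size l * nu] points,
    which is the increment of the binomial term. *)
Lemma bonferroni (I : eqType) (T : finType) (K : I -> {set T}) a nu (l : seq I) :
  uniq l -> {in l, forall i, a <= #|K i|} ->
  {in l &, forall i j, i != j -> #|K i :&: K j| <= nu} ->
  size l * a <= #|\bigcup_(i <- l) K i| + 'C(size l, 2) * nu.
Proof.
elim: l => [|i l IH] //= /andP[il ul] ha hnu.
rewrite big_cons mulSn binS bin1.
have {}IH : size l * a <= #|\bigcup_(i <- l) K i| + 'C(size l, 2) * nu.
  apply: IH => // [j jl|j k jl kl]; first by rewrite ha // in_cons jl orbT.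
  by apply: hnu; rewrite in_cons ?jl ?kl orbT.
have hi := ha i (mem_head _ _).
have hU := cardsUI (K i) (\bigcup_(j <- l) K j).
have : #|K i :&: \bigcup_(j <- l) K j| <= size l * nu.
  have -> : K i :&: \bigcup_(j <- l) K j = \bigcup_(j <- l) (K i :&: K j).
    by rewrite big_distrr.
  apply: card_bigcup_le => j jl; apply: hnu; rewrite ?mem_head // ?in_cons ?jl ?orbT //.
  by apply: contraNneq il => ->.
rewrite mulnDl; lia.
Qed.

(** * Metsch's construction of lines *)

Section Lines.
(* [lam] is [a_1], [nu] is [c_2 - 1] and [s] is [m - 1]: shifting the last two
   avoids truncated subtraction. *)
Variables (T : finType) (e : rel T) (lam nu s : nat).
Hypotheses (e_sym : symmetric e) (e_irr : irreflexive e).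

Definition nbrs (x : T) : {set T} := [set z | e x z].
Definition cliqueb (C : {set T}) := [forall x in C, forall y in C, (x != y) ==> e x y].
Definition line (L : {set T}) := maxset cliqueb L && (lam.+2 <= #|L| + s * nu).
Definition coclique (x : T) (I : {set T}) :=
  (I \subset nbrs x) && [forall y in I, forall z in I, ~~ e y z].

Lemma cliqueP (C : {set T}) : reflect {in C &, forall x y, x != y -> e x y} (cliqueb C).
Proof.
apply: (iffP forall_inP) => [h x y xC yC xy|h x xC].
  by move/forall_inP: (h x xC) => /(_ y yC)/implyP/(_ xy).
by apply/forall_inP=> y yC; apply/implyP; apply: h.
Qed.

Lemma cocliqueP x (I : {set T}) :
  reflect ({in I, forall y, e x y} /\ {in I &, forall y z, e y z = false})
    (coclique x I).
Proof.
apply: (iffP andP) => [[/subsetP h /forall_inP h2]|[h h2]]; split.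
- by move=> y /h; rewrite inE.
- by move=> y z yI zI; apply/negbTE; move/forall_inP: (h2 y yI) => /(_ z zI).
- by apply/subsetP=> y yI; rewrite inE h.
- by apply/forall_inP=> y yI; apply/forall_inP=> z zI; rewrite h2.
Qed.

Hypothesis adj : forall x y, e x y -> #|nbrs x :&: nbrs y| = lam.
Hypothesis nonadj : forall x y, x != y -> ~~ e x y -> #|nbrs x :&: nbrs y| <= nu.+1.

(** [x] is itself one of the at most [nu.+1] common neighbours of [y] and [z]. *)
Lemma nonadj_local x y z : e x y -> e x z -> y != z -> ~~ e y z ->
  #|nbrs x :&: (nbrs y :&: nbrs z)| <= nu.
Proof.
move=> xy xz yz nyz; have := nonadj yz nyz.
rewrite (cardsD1 x) !inE (e_sym y) (e_sym z) xy xz /= add1n ltnS; apply: leq_trans.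
apply/subset_leq_card/subsetP=> w; rewrite !inE => /and3P[xw -> ->]; rewrite !andbT.
by apply: contraTneq xw => ->; rewrite e_irr.
Qed.

(** Otherwise [s.+2] members [y] give sets [y |: (nbrs x :&: nbrs y)] of size [lam.+1] among the [k]
    neighbours of [x], pairwise meeting in at most [nu] vertices, against [bonferroni]. *)
Lemma coclique_card k x I : #|nbrs x| = k ->
  k + 'C(s.+2, 2) * nu < s.+2 * lam.+1 -> coclique x I -> #|I| <= s.+1.
Proof.
move=> kE hk /cocliqueP[xI cI]; rewrite leqNgt; apply/negP=> hI.
pose l := take s.+2 (enum I).
have sl : size l = s.+2 by rewrite size_takel // -cardE.
have lI y : y \in l -> y \in I by move/mem_take; rewrite mem_enum.
pose K y := y |: (nbrs x :&: nbrs y).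
have := @bonferroni _ _ K lam.+1 nu l; rewrite sl.
have ul : uniq l by rewrite take_uniq ?enum_uniq.
move=> /(_ ul) h.
suff: s.+2 * lam.+1 <= k + 'C(s.+2, 2) * nu by lia.
apply: leq_trans (h _ _) _.
- by move=> y /lI yI; rewrite cardsU1 !inE e_irr andbF add1n adj ?xI.
- move=> y z /lI yI /lI zI yz; apply: leq_trans (@nonadj_local x y z _ _ yz _); rewrite ?xI ?cI //.
  apply/subset_leq_card/subsetP=> w; rewrite !inE.
  case/andP=> /predU1P[->|/andP[xw yw]] /predU1P[E|/andP[_ zw]].
  + by rewrite E eqxx in yz.
  + by rewrite cI in zw.
  + by rewrite E cI in yw.
  + by rewrite xw yw zw.
rewrite leq_add2r -kE; apply/subset_leq_card.
rewrite big_seq; elim/big_ind: _ => [|A B hA hB|y /lI yI].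
- exact: sub0set.
- by rewrite subUset hA.
by rewrite subUset sub1set subsetIl inE xI.
Qed.

(** For a maximum coclique [I], this set together with [x] is the clique that seeds the line
    belonging to [i]. *)
Definition private (x : T) (I : {set T}) (i : T) : {set T} :=
  [set z in i |: (nbrs x :&: nbrs i) | [forall j in I :\ i, ~~ e j z]].

Lemma privateP x (I : {set T}) i z : reflect
  [/\ (z == i) || e x z && e i z & {in I, forall j, j != i -> e j z = false}]
  (z \in private x I i).
Proof.
rewrite !inE; apply: (iffP andP) => -[zi h]; split=> //.
  move=> j jI ji; apply/negbTE; move/forall_inP: h; apply.
  by rewrite !inE ji.
by apply/forall_inP=> j; rewrite !inE => /andP[ji jI]; rewrite h.
Qed.

(** Each other member of [I] removes at most [nu] of the [lam.+1] candidates. *)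
Lemma card_private x I i : coclique x I -> i \in I ->
  lam.+1 <= #|private x I i| + #|I|.-1 * nu.
Proof.
move=> /cocliqueP[xI cI] iI.
have <- : #|i |: (nbrs x :&: nbrs i)| = lam.+1.
  by rewrite cardsU1 !inE e_irr andbF add1n adj ?xI.
pose B j := nbrs x :&: (nbrs i :&: nbrs j).
have hB : #|\bigcup_(j <- enum (I :\ i)) B j| <= #|I|.-1 * nu.
  have -> : #|I|.-1 = size (enum (I :\ i)) by rewrite -cardE (cardsD1 i I) iI.
  apply: card_bigcup_le => j; rewrite mem_enum !inE => /andP[ji jI].
  by apply: nonadj_local; rewrite ?xI ?cI // eq_sym.
apply: leq_trans (leq_add (leqnn _) hB).
apply: leq_trans (leq_card_setU _ _).
apply/subset_leq_card/subsetP=> z; rewrite inE => zK; rewrite in_setU.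
case: (boolP (z \in private x I i)) => //= /privateP zn.
suff [j [jI ji jz]] : exists j, [/\ j \in I, j != i & e j z].
  have /andP[xz iz] : e x z && e i z.
    case/orP: zK => [|]; rewrite !inE // => /eqP zi; by rewrite zi cI in jz.
  rewrite big_enum /=; apply/bigcupP; exists j; rewrite !inE ?ji //.
  by rewrite xz iz jz.
case: (boolP [exists j in I, (j != i) && e j z]) => [/exists_inP[j jI /andP[ji jz]]|].
  by exists j.
rewrite negb_exists_in => /forall_inP h; case: zn; split.
  by move: zK; rewrite !inE.
by move=> j jI ji; move: (h j jI); rewrite ji /= => /negbTE.
Qed.

(** * Maximum cocliques and the cliques they seed *)

Section MaxCoclique.
Variables (x : T) (I : {set T}).
Hypotheses (cocI : coclique x I) (maxI : forall J, coclique x J -> #|J| <= #|I|).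

Lemma coclique_sub (J J' : {set T}) : J' \subset J -> coclique x J -> coclique x J'.
Proof.
move=> /subsetP h /cocliqueP[xJ cJ]; apply/cocliqueP; split.
  by move=> y /h/xJ.
by move=> y z /h yJ /h; apply: cJ.
Qed.

Lemma cocliqueU1 (J : {set T}) z : coclique x J -> e x z ->
  {in J, forall y, e y z = false} -> coclique x (z |: J).
Proof.
move=> /cocliqueP[xJ cJ] xz h; apply/cocliqueP; split.
  by move=> y /setU1P[->|/xJ].
move=> y y' /setU1P[->|yJ] /setU1P[->|y'J].
- by rewrite e_irr.
- by rewrite e_sym h.
- by rewrite h.
- exact: cJ.
Qed.

Lemma private_nbr i z : i \in I -> z \in private x I i -> e x z.
Proof.
case/cocliqueP: cocI => xI _ iI /privateP[/predU1P[->|/andP[]] // _].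
exact: xI.
Qed.

Lemma private_disjoint i j z : i \in I -> j \in I -> i != j ->
  z \in private x I i -> z \notin private x I j.
Proof.
case/cocliqueP: cocI => xI cI iI jI ij /privateP[zi hi]; apply/privateP=> -[zj hj].
case/predU1P: zj => [zj|/andP[_ jz]]; last by rewrite hi // eq_sym in jz.
case/predU1P: zi => [zi|/andP[_ iz]]; last by rewrite hj in iz.
by rewrite -zi zj eqxx in ij.
Qed.

(** Two non-adjacent private vertices could replace [i] in [I], giving a larger coclique. *)
Lemma private_clique i : i \in I -> cliqueb (x |: private x I i).
Proof.
move=> iI; have xp z : z \in private x I i -> e x z by apply: private_nbr.
apply/cliqueP=> y z /setU1P[->|yp] /setU1P[->|zp] yz.
- by rewrite eqxx in yz.
- exact: xp.
- by rewrite e_sym; apply: xp.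
apply/negPn/negP=> nyz.
have D w : w \in private x I i -> w \notin I :\ i.
  move=> wp; rewrite !inE; apply/andP=> -[wi wI].
  move/privateP: wp => [/predU1P[E|/andP[_ iw]] _]; first by rewrite E eqxx in wi.
  by case/cocliqueP: cocI => _ cI; rewrite cI in iw.
have hz : {in I :\ i, forall j, e j z = false}.
  by move=> j; rewrite !inE => /andP[ji jI]; case/privateP: zp => _; apply.
have hy : {in z |: I :\ i, forall j, e j y = false}.
  move=> j /setU1P[->|]; first by apply/negbTE; rewrite e_sym.
  by rewrite !inE => /andP[ji jI]; case/privateP: yp => _; apply.
have c1 := cocliqueU1 (coclique_sub (subsetDl I [set i]) cocI) (xp _ zp) hz.
have := maxI (cocliqueU1 c1 (xp _ yp) hy).
rewrite !cardsU1 (D z zp) in_setU1 (negbTE yz) (D y yp) /= (cardsD1 i I) iI.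
lia.
Qed.

Hypotheses (cardI : #|I| <= s.+1) (lam_large : s.*2.+1 * nu <= lam).

(** By maximality of [L] some [u] in [L] is not adjacent to [y]; the vertices counted are common
    neighbours of [x], [y] and [u]. *)
Lemma nonline_nbrs i y L : i \in I -> e x y -> maxset cliqueb L ->
  x |: private x I i \subset L -> y \notin L -> #|private x I i :&: nbrs y| <= nu.
Proof.
move=> iI xy /maxsetP[/cliqueP cL mL] /subsetP sL yL.
have xL : x \in L by rewrite sL ?setU11.
have [u uL uy] : exists2 u, u \in L & ~~ e u y.
  apply/exists_inP; apply: contraR yL; rewrite negb_exists_in => /forall_inP h.
  rewrite -(mL (y |: L)) ?setU11 ?subsetUr //.
  apply/cliqueP=> a b /setU1P[->|aL] /setU1P[->|bL] ab.
  - by rewrite eqxx in ab.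
  - by rewrite e_sym; move: (h b bL); rewrite negbK.
  - by move: (h a aL); rewrite negbK.
  - exact: cL.
have yu : y != u by apply: contraNneq yL => ->.
have xu : x != u by apply: contraNneq uy => <-.
have eu := cL _ _ xL uL xu.
rewrite e_sym in uy; apply: leq_trans (nonadj_local xy eu yu uy).
apply/subset_leq_card/subsetP=> w /setIP[wp]; rewrite inE => yw.
rewrite !inE (private_nbr iI wp) yw /=.
apply: cL => //; first by rewrite sL // setU1r.
by apply: contraNneq uy => ->.
Qed.

(* Otherwise [y] and one suitable vertex from each [private x I i] would form
   a coclique larger than [I]. *)
Lemma max_coclique_cover (L : T -> {set T}) y :
  {in I, forall i, maxset cliqueb (L i)} ->
  {in I, forall i, x |: private x I i \subset L i} ->
  e x y -> exists2 i, i \in I & y \in L i.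
Proof.
move=> mL sL xy; apply/exists_inP; rewrite -[X in is_true X]negbK negb_exists_in.
apply/negP=> /forall_inP yL.
have yp i : i \in I -> y \notin private x I i.
  move=> iI; apply: contra (yL i iI) => yp; apply: (subsetP (sL i iI)).
  by rewrite setU1r.
(* [Z] consists of [y] and one private vertex for each member of [l]; for [l = enum I] it is larger
   than [I]. *)
suff H (l : seq T) : uniq l -> {subset l <= I} -> exists Z, [/\ coclique x Z,
    #|Z| = (size l).+1 &
    {in Z, forall z, z != y -> exists2 i, i \in l & z \in private x I i}].
  have [|Z [cZ sZ _]] := H (enum I) (enum_uniq _); first by move=> z; rewrite mem_enum.
  by have := maxI cZ; rewrite sZ -cardE ltnn.
elim: l => [|i l IH] /=.
  move=> _ _; exists [set y]; rewrite cards1; split=> // [|z /set1P->]; last by rewrite eqxx.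
  by apply/cocliqueP; split=> [z /set1P->|z z' /set1P-> /set1P->] //.
case/andP=> il ul lI; have iI : i \in I by rewrite lI ?mem_head.
have lI' : {subset l <= I} by move=> j jl; rewrite lI // in_cons jl orbT.
have [Z [cZ sZ hZ]] := IH ul lI'.
have sl : (size l).+1 <= #|I|.
  by rewrite cardE; apply: (@uniq_leq_size _ (i :: l)) => /=;
     [rewrite il | move=> j /lI; rewrite mem_enum].
have Zp z : z \in Z -> z \notin private x I i.
  move=> zZ; have [->|/(hZ z zZ)[j jl zp]] := eqVneq z y; first exact: yp.
  apply: private_disjoint (lI' j jl) iI _ zp.
  by apply: contraNneq il => <-.
(* If [z] is not [y], it is private to some [j != i], hence not adjacent to [i], and [nonadj_local]
   applies to [i] and [z]. *)
have hZi z : z \in Z -> #|private x I i :&: nbrs z| <= nu.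
  move=> zZ; have [->|/(hZ z zZ)[j jl zp]] := eqVneq z y.
    by apply: nonline_nbrs (mL i iI) (sL i iI) _; rewrite ?yL.
  have ij : i != j by apply: contraNneq il => ->.
  case/cocliqueP: cocI => xI cI.
  have zi : e i z = false by case/privateP: zp => _; apply.
  have iz : i != z.
    apply: contraTneq zp => <-; apply: private_disjoint (_ : i \in private x I i) => //.
    + exact: lI'.
    + by apply/privateP; rewrite eqxx; split=> // k kI _; rewrite cI.
  have := @nonadj_local x i z; rewrite zi => /(_ (xI _ iI)) h.
  apply: leq_trans (h _ iz isT); last by apply: private_nbr zp; rewrite lI'.
  apply/subset_leq_card/subsetP=> w /setIP[/privateP[wi _]]; rewrite !inE => zw.
  rewrite zw andbT; case/predU1P: wi => // E.
  by rewrite E e_sym zi in zw.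
have [w wp wZ] : exists2 w, w \in private x I i & {in Z, forall z, e z w = false}.
  pose U := \bigcup_(z <- enum Z) (private x I i :&: nbrs z).
  have hU : #|U| <= size (enum Z) * nu.
    by apply: card_bigcup_le => z; rewrite mem_enum; apply: hZi.
  (* [Z] excludes at most [(size l).+1 * nu] vertices and [card_private] loses [#|I|.-1 * nu]:
     together at most [s.*2.+1 * nu <= lam], out of [lam.+1]. *)
  have : #|U| < #|private x I i|.
    have := card_private cocI iI; move: hU; rewrite -cardE sZ.
    move: lam_large cardI sl.
    move: #|U| #|private x I i| => u p; case: #|I| => [//|r] /=; rewrite ltnS => h1 h2 h3 h4 h5.
    have : (size l).+1 * nu + r * nu <= s.*2.+1 * nu by rewrite -mulnDl leq_mul2r; lia.
    lia.
  move=> hlt; have /subsetPn[w wp wU] : ~~ (private x I i \subset U).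
    by apply: contraL hlt => /subset_leq_card; rewrite -leqNgt.
  exists w => // z zZ; apply: contraNF wU => zw; rewrite /U big_enum /=.
  by apply/bigcupP; exists z => //; rewrite in_setI wp inE.
exists (w |: Z); split.
- exact: cocliqueU1 (private_nbr iI wp) wZ.
- rewrite cardsU1 sZ; suff -> : w \notin Z by [].
  by apply/negP=> /Zp; rewrite wp.
move=> z /setU1P[-> _|zZ zy]; first by exists i; rewrite ?mem_head.
by have [j jl zp] := hZ z zZ zy; exists j; rewrite // in_cons jl orbT.
Qed.

End MaxCoclique.

(** * Uniqueness and number of lines *)

Hypothesis lam_large : s.*2.+1 * nu <= lam.

(** If the union is a clique, maximality identifies both lines with it. Otherwise it contains
    non-adjacent [a] in [L1] and [b] in [L2], so the intersection has at most [nu.+1] vertices; the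
    union has at most [lam.+2], and the sizes of the lines force [lam < s.*2.+1 * nu]. *)
Lemma line_unique L1 L2 x y : line L1 -> line L2 -> e x y ->
  x \in L1 -> y \in L1 -> x \in L2 -> y \in L2 -> L1 = L2.
Proof.
move=> /andP[/maxsetP[cl1 m1] h1] /andP[/maxsetP[cl2 m2] h2] xy x1 y1 x2 y2.
have /cliqueP c1 := cl1; have /cliqueP c2 := cl2.
have [/cliqueP cU|ncU] := boolP (cliqueb (L1 :|: L2)).
  have cU' : cliqueb (L1 :|: L2) by apply/cliqueP.
  by rewrite -[RHS](m2 _ cU') ?subsetUr // -[LHS](m1 _ cU') ?subsetUl.
exfalso.
have [a a1 [b b2 /andP[ab nab]]] :
    exists2 a, a \in L1 & exists2 b, b \in L2 & (a != b) && ~~ e a b.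
  suff /exists_inP[a a1 /exists_inP[b]] :
      [exists a in L1, [exists b in L2, (a != b) && ~~ e a b]].
    by exists a => //; exists b.
  apply: contraR ncU; rewrite negb_exists_in => /forall_inP h.
  have h12 a b : a \in L1 -> b \in L2 -> a != b -> e a b.
    move=> /h; rewrite negb_exists_in => /forall_inP{}h /h.
    by rewrite negb_and !negbK => /orP[->|].
  apply/cliqueP=> a b /setUP[aL|aL] /setUP[bL|bL] ab.
  - exact: c1.
  - exact: h12.
  - by rewrite e_sym h12 // eq_sym.
  - exact: c2.
have a2 : a \notin L2 by apply: contra nab => a2; apply: c2.
have b1 : b \notin L1 by apply: contra nab => b1; apply: c1.
have hI : #|L1 :&: L2| <= nu.+1.
  apply: leq_trans (nonadj ab nab).
  apply/subset_leq_card/subsetP=> w /setIP[w1 w2]; rewrite !inE.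
  by rewrite c1 ?c2 //; [apply: contraNneq b1 => -> | apply: contraNneq a2 => ->].
have xney : x != y by apply: contraTneq xy => ->; rewrite e_irr.
have hU : #|(L1 :|: L2) :\ x :\ y| <= lam.
  rewrite -(adj xy); apply/subset_leq_card/subsetP=> w; rewrite !inE.
  case/and3P=> wy wx /orP[wL|wL].
    by rewrite !c1 // eq_sym.
  by rewrite !c2 // eq_sym.
have := cardsUI L1 L2; move: hU hI h1 h2.
rewrite (cardsD1 x (L1 :|: L2)) (cardsD1 y ((L1 :|: L2) :\ x)) !inE x1 y1 eq_sym xney /=.
move: lam_large; rewrite -addnn mulSn mulnDl.
move: #|_ :\ y| #|L1 :&: L2| #|L1| #|L2| (s * nu) => u i l1 l2 t.
clear; lia.
Qed.

Lemma line_card_ge2 L : line L -> 1 < #|L|.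
Proof.
case/andP=> _; move: lam_large; rewrite -addnn mulSn mulnDl; lia.
Qed.

Section Valency.
Variable k : nat.
Hypotheses (val : forall x, #|nbrs x| = k)
  (k_small : k + 'C(s.+2, 2) * nu < s.+2 * lam.+1).

Lemma lines_through x : exists (I : {set T}) (L : T -> {set T}),
  [/\ #|I| <= s.+1, {in I, forall i, line (L i)} &
  forall y, e x y -> exists i, [/\ i \in I, x \in L i & y \in L i]].
Proof.
have c0 : coclique x set0 by apply/cocliqueP; split=> y; rewrite inE.
have [I cI mI] := @arg_maxnP _ set0 (coclique x) (fun I : {set T} => #|I|) c0.
have hI := coclique_card (val x) k_small cI.
(* The default [set0] never occurs for [i] in [I]: the seed extends to a maximal clique, large
   enough by [card_private]. *)
pose L i := odflt set0 [pick L | line L && (x |: private x I i \subset L)].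
have hL i : i \in I -> line (L i) /\ x |: private x I i \subset L i.
  move=> iI; rewrite /L; case: pickP => [M /andP[]//|h]; exfalso.
  have [M mM sM] := maxset_exists (private_clique cI mI iI).
  move: (h M); rewrite sM andbT /line mM /= => /negP; apply.
  apply: leq_trans (leq_add (subset_leq_card sM) (leqnn _)).
  rewrite cardsU1; suff -> : x \notin private x I i.
    have : #|I|.-1 * nu <= s * nu by rewrite leq_mul2r; lia.
    have := card_private cI iI; lia.
  by apply/negP=> /(private_nbr cI iI); rewrite e_irr.
exists I, L; split=> // [i /hL[]//|y xy].
have [||i iI yL] := @max_coclique_cover x I cI mI hI lam_large L y _ _ xy.
- by move=> i /hL[/andP[]].
- by move=> i /hL[].
by exists i; split=> //; have [_ /subsetP] := hL i iI; apply; rewrite setU11.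
Qed.

Lemma edge_in_line x y : e x y -> exists L, [/\ line L, x \in L & y \in L].
Proof.
move=> xy; have [I [L [_ hL /(_ y xy)[i [iI xi yi]]]]] := lines_through x.
by exists (L i); split=> //; apply: hL.
Qed.

(** A line on [x] contains an edge at [x], which also lies on some [L i]; by [line_unique] the line
    is that [L i]. *)
Lemma card_lines_through x : #|[set L | line L & x \in L]| <= s.+1.
Proof.
have [I [L [hI hL cov]]] := lines_through x.
apply: leq_trans hI; apply: leq_trans (leq_imset_card L I).
apply/subset_leq_card/subsetP=> M; rewrite inE => /andP[lM xM].
have : 0 < #|M :\ x| by have := line_card_ge2 lM; rewrite (cardsD1 x M) xM.
case/card_gt0P=> y; rewrite !inE => /andP[yx yM].
have xy : e x y.
  by case/andP: lM => /maxsetP[/cliqueP cM _] _; apply: cM; rewrite // eq_sym.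
have [i [iI xi yi]] := cov y xy; apply/imsetP; exists i => //.
exact: line_unique lM (hL i iI) xy xM yM xi yi.
Qed.

End Valency.
End Lines.

(** * Spectral tools *)

Section Spectral.
Local Open Scope ring_scope.
Local Open Scope sesquilinear_scope.

(* The spectral theorem is available over [R[i]] only, so [A] is diagonalized
   there; its eigenvalues are real since it is hermitian. *)
Lemma rayleigh (R : rcfType) n (A : 'M[R]_n) (theta : R) (v : 'rV[R]_n) :
  A^T = A -> (forall mu, eigenvalue A mu -> theta <= mu) ->
  theta * (v *m v^T) 0 0 <= (v *m A *m v^T) 0 0.
Proof.
move=> Asym hmin.
pose f := real_complex R; pose B := map_mx f A; pose w := map_mx f v.
have conjf m p (M : 'M[R]_(m, p)) : map_mx Num.conj (map_mx f M) = map_mx f M.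
  apply/matrixP=> i j; rewrite !mxE; exact: conjc_real.
have Bherm : B \is hermsymmx.
  apply: realsym_hermsym.
    apply/is_hermitianmxP; rewrite expr0 scale1r.
    by apply/matrixP=> i j; rewrite !mxE -[in LHS]Asym mxE.
  by apply/mxOverP=> i j; rewrite mxE complex_real.
have Dreal := hermitian_spectral_diag_real Bherm.
have Puni := spectral_unitarymx B.
have /orthomx_spectralP := hermitian_normalmx Bherm.
rewrite invmx_unitary //.
set P := spectralmx B in Puni *; set D := spectral_diag B in Dreal * => BE.
have PBP : P *m B = diag_mx D *m P.
  by rewrite BE !mulmxA (unitarymxP Puni) mul1mx.
(* Rows of the unitary [P] are nonzero eigenvectors of [B]; their real eigenvalues pass to [A]
   through the characteristic polynomial. *)
have Dge i : f theta <= D 0 i.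
  have /mxOverP/(_ 0 i) := Dreal.
  case/complex_realP=> mu muE; rewrite muE lecR; apply: hmin.
  have : eigenvalue B (f mu).
    apply/eigenvalueP; exists (row i P).
      rewrite -row_mul PBP; apply/rowP=> j.
      by rewrite mul_diag_mx !mxE muE.
    apply/eqP=> Pi0; have := Puni => /row_unitarymxP/(_ i i).
    rewrite Pi0 eqxx dotmxE mul0mx mxE => /esym/eqP; by rewrite oner_eq0.
  rewrite !eigenvalue_root_char.
  by rewrite -map_char_poly fmorph_root.
pose z := w *m P^t*.
have wz : w = z *m P by rewrite /z mulmxKtV.
have wT : map_mx f v^T = P^t* *m z^t*.
  transitivity (w^t*); first by rewrite map_trmx conjf.
  by rewrite [in LHS]wz trmx_mul map_mxM.
rewrite -lecR rmorphM /= -!/(f _).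
have -> : f ((v *m v^T) 0 0) = \sum_i z 0 i * (z 0 i)^*.
  transitivity (map_mx f (v *m v^T) 0 0); first by rewrite [RHS]mxE.
  rewrite map_mxM wT -/w wz !mulmxA mulmxtVK // mxE.
  by apply: eq_bigr => i _; rewrite !mxE.
have -> : f ((v *m A *m v^T) 0 0) = \sum_i D 0 i * (z 0 i * (z 0 i)^*).
  transitivity (map_mx f (v *m A *m v^T) 0 0); first by rewrite [RHS]mxE.
  rewrite !map_mxM wT -/w wz -/B -[z *m P *m B]mulmxA PBP !mulmxA mulmxtVK //.
  rewrite mul_mx_diag mxE.
  by apply: eq_bigr => i _; rewrite !mxE mulrA; congr (_ * _); rewrite mulrC.
rewrite mulr_sumr ler_sum // => i _.
by rewrite ler_wpM2r ?mul_conjC_ge0.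
Qed.

(** [E] is [q(A)], where [q] is the minimal polynomial divided by its factor at [theta]; it is not
    normalized. The last clause is induction over polynomials in [A]. *)
Lemma eigen_idempotent (F : fieldType) n (A : 'M[F]_n) (theta : F) :
  eigenvalue A theta ->
  exists E : 'M[F]_n, [/\ E != 0, E *m A = theta *: E &
    forall P : 'M[F]_n -> Prop, P 1%:M -> (forall M, P M -> P (M *m A)) ->
      (forall a M N, P M -> P N -> P (a *: M + N)) -> P E].
Proof.
case: n A => [|n] A.
  by case/eigenvalueP=> v _ /eqP[]; apply/rowP=> -[].
rewrite eigenvalue_root_min => /factor_theorem[q qE].
have q0 : q != 0.
  by apply: contra_eq_neq qE => ->; rewrite mul0r monic_neq0 // mxminpoly_monic.
exists (horner_mx A q); split.
- apply: contraTneq (dvdpp q) => /mxminpoly_min; rewrite qE => /(dvdp_leq q0).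
  by rewrite size_Mmonic ?monicXsubC // size_XsubC addn2 ltnn.
- have := mx_root_minpoly A.
  rewrite qE rmorphM rmorphB /= horner_mx_X horner_mx_C mulrBr -!mulmxE.
  by move/subr0_eq ->; rewrite mul_mx_scalar.
move=> P P1 PA PZ; elim/poly_ind: q {qE q0} => [|p a IH].
  rewrite rmorph0; have := PZ (-1) _ _ P1 P1.
  by rewrite scaleN1r addNr.
rewrite rmorphD rmorphM /= horner_mx_X horner_mx_C addrC -scalemx1.
exact: PZ (PA _ IH).
Qed.

(* The point-block incidence matrix [N] satisfies [N N^T = A + m]; having fewer
   columns than rows, it has a nontrivial left kernel. *)
Lemma linear_space_eigenvalue (R : realType) (T : finType) (e : rel T)
    (CC : {set {set T}}) (m : nat) : irreflexive e ->
  (forall x y, x != y -> #|[set L in CC | (x \in L) && (y \in L)]| = e x y) ->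
  (forall x, #|[set L in CC | x \in L]| = m) ->
  (#|CC| < #|T|)%N -> eigenvalue (adjmx e R) (- m%:R).
Proof.
move=> e_irr pairs points lt.
pose N : 'M[R]_(#|T|, #|CC|) := \matrix_(i, j) ((enum_val i : T) \in (enum_val j : {set T}))%:R.
have NNT : N *m N^T = adjmx e R + m%:R%:M.
  apply/matrixP=> i j; rewrite !mxE.
  under eq_bigr => l _ do rewrite !mxE -natrM mulnb.
  rewrite -(big_enum_val (fun L : {set T} => ((enum_val i \in L) && (enum_val j \in L))%:R)) /=.
  rewrite -natr_sum -big_mkcondr sum1dep_card.
  have [->|ij] := eqVneq i j.
    rewrite e_irr add0r mulr1n -(points (enum_val j)); congr _%:R.
    by apply: eq_card => L; rewrite !inE andbb.
  by rewrite mulr0n addr0 -pairs // (inj_eq enum_val_inj).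
have /rowV0Pn[v /sub_kermxP vN v0] : kermx N != 0.
  rewrite -mxrank_eq0 mxrank_ker -lt0n subn_gt0.
  exact: leq_ltn_trans (rank_leq_col _) lt.
apply/eigenvalueP; exists v => //.
have : v *m (N *m N^T) = 0 by rewrite mulmxA vN mul0mx.
rewrite NNT mulmxDr mul_mx_scalar => /eqP; rewrite addr_eq0 => /eqP->.
by rewrite scaleNr.
Qed.

End Spectral.

(** * Counting neighbours through blocks *)

Section Counting.
Variables (T : finType) (e : rel T) (CC : {set {set T}}) (k : nat).
Hypotheses (e_irr : irreflexive e)
  (cl : {in CC, forall L : {set T}, clique e L})
  (edge : forall x y, e x y -> #|[set L in CC | (x \in L) && (y \in L)]| = 1%N)
  (val : forall x, #|nbrs e x| = k).

(** Double counting: a neighbour of [x] shares exactly one block with [x]; any other vertex distinct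
    from [x] shares none, blocks being cliques. *)
Lemma sum_card_blocks x :
  (\sum_(L in CC | x \in L) #|L :\ x| = k)%N.
Proof.
rewrite -(val x) -sum1_card.
under eq_bigr => L _ do rewrite -sum1_card big_mkcond.
rewrite exchange_big /= [RHS]big_mkcond /=; apply: eq_bigr => y _.
rewrite inE; case xy: (e x y).
  have yx : y != x by apply: contraTneq xy => ->; rewrite e_irr.
  transitivity #|[set L in CC | (x \in L) && (y \in L)]|; last exact: edge.
  rewrite -sum1dep_card -big_mkcondr; apply: eq_bigl => L.
  by rewrite !inE yx -andbA.
apply: big1 => L /andP[LC xL]; rewrite !inE; case: eqVneq => //= yx.
by case yL: (y \in L) => //; rewrite (cl LC) // eq_sym in xy.
Qed.
End Counting.

(** * Distance-regular graphs *)

Section Distance.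
Variables (T : finType) (e : rel T).

Lemma mem_nbhd (A : {set T}) z :
  (z \in nbhd e A) = (z \in A) || [exists w in A, e w z].
Proof. by rewrite !inE. Qed.

Lemma ball_mono x m n : m <= n -> ball e x m \subset ball e x n.
Proof.
elim: n => [|n IH]; first by rewrite leqn0 => /eqP->.
rewrite leq_eqVlt => /predU1P[->//|/IH h]; apply: subset_trans h _.
by apply/subsetP=> z zb; rewrite /ball iterS mem_nbhd zb.
Qed.

Hypothesis conn : connected e.

Lemma mem_ball x y n : (y \in ball e x n) = (dist e x y <= n).
Proof.
apply/idP/idP => [yb|].
  have [nT|nT] := ltnP n #|T|; last first.
    by apply: leq_trans nT; rewrite -[leqRHS](size_iota 0 #|T|) find_size.
  rewrite leqNgt; apply/negP=> /[dup] lt /(before_find 0).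
  by rewrite nth_iota // add0n yb.
move=> /(ball_mono x)/subsetP; apply; rewrite /dist.
set p := fun n => _; have [h|h] := boolP (has p (iota 0 #|T|)).
  have := nth_find 0 h; rewrite nth_iota // -[ltnRHS](size_iota 0 #|T|).
  by rewrite -has_find.
(* A failed search returns [#|T|], and connectedness puts [y] in the ball of that radius. *)
by rewrite hasNfind // size_iota; apply: conn.
Qed.

Lemma dist_adj x y z : e y z -> dist e x z <= (dist e x y).+1.
Proof.
move=> yz; rewrite -mem_ball /ball iterS mem_nbhd; apply/orP; right.
by apply/exists_inP; exists y => //; rewrite -/(ball e x _) mem_ball.
Qed.

Lemma dist_eq0 x y : (dist e x y == 0) = (x == y).
Proof. by rewrite -leqn0 -mem_ball inE eq_sym. Qed.

Lemma dist_pred x y n : dist e x y = n.+1 -> exists2 z, dist e x z = n & e z y.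
Proof.
move=> xy; have : y \in ball e x n.+1 by rewrite mem_ball xy.
rewrite /ball iterS mem_nbhd -/(ball e x n) mem_ball xy ltnn /=.
case/exists_inP=> z; rewrite mem_ball => zn zy; exists z => //.
by have := dist_adj x zy; rewrite xy ltnS => h; apply/eqP; rewrite eqn_leq zn.
Qed.

Lemma exists_dist2 : 2 <= diameter e -> exists x y, dist e x y = 2.
Proof.
move=> h2; have [x [y]] : exists x y, 2 <= dist e x y.
  suff /existsP[x /existsP[y]] : [exists x, [exists y, 2 <= dist e x y]].
    by exists x, y.
  apply: contraTT h2 => /existsPn h; rewrite -leqNgt.
  apply/bigmax_leqP=> x _; apply/bigmax_leqP=> y _; rewrite leqNgt.
  by move: (h x) => /existsPn; apply.
move=> hxy; exists x; move: hxy; move dE: (dist e x y) => d; elim: d y dE => // d IH y dE.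
rewrite leq_eqVlt => /predU1P[E|lt2]; first by exists y; rewrite dE.
by have [z zd _] := dist_pred dE; apply: IH zd lt2.
Qed.

Hypothesis e_irr : irreflexive e.

Lemma dist_eq1 x y : (dist e x y == 1) = e x y.
Proof.
apply/eqP/idP => [/dist_pred[z /eqP]|xy]; first by rewrite dist_eq0 => /eqP->.
apply/eqP; rewrite eqn_leq lt0n dist_eq0.
have /eqP x0 : dist e x x == 0 by rewrite dist_eq0.
have := dist_adj x xy; rewrite x0 => -> /=.
by apply: contraTneq xy => ->; rewrite e_irr.
Qed.
End Distance.

Section DistanceRegular.
Variables (T : finType) (e : rel T) (b c : nat -> nat).
Hypothesis drg : distance_regular e b c.

Let e_sym : symmetric e. Proof. by case: drg => -[]. Qed.
Let e_irr : irreflexive e. Proof. by case: drg => -[]. Qed.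
Let conn : connected e. Proof. by case: drg. Qed.
Let hc x y : #|[set z | e y z & dist e x z == (dist e x y).-1]| = c (dist e x y).
Proof. by case: drg => _ _ /(_ x y)[]. Qed.
Let hb x y : #|[set z | e y z & dist e x z == (dist e x y).+1]| = b (dist e x y).
Proof. by case: drg => _ _ /(_ x y)[]. Qed.
Let dist0 x : dist e x x = 0. Proof. by apply/eqP; rewrite dist_eq0. Qed.
Let dist1 x y : e x y -> dist e x y = 1. Proof. by rewrite -dist_eq1 // => /eqP. Qed.

Lemma drg_valency x : #|nbrs e x| = b 0.
Proof.
have := hb x x; rewrite dist0 => <-; apply: eq_card => z; rewrite !inE.
by rewrite dist_eq1 // andbb.
Qed.

(** Among the neighbours of [y], [c 1] counts those at distance 0 from [x] and [b 1] those at
    distance 2; the rest are at distance 1. *)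
Lemma drg_adj x y : e x y -> #|nbrs e x :&: nbrs e y| = b 0 - b 1 - c 1.
Proof.
move=> xy; have := hb x y; have := hc x y; rewrite (dist1 xy) -(drg_valency y) => <- <-.
set C := [set z | _ & _ == _.-1]; set B := [set z | _ & _ == _.+1].
have d3 z : e y z -> dist e x z <= 2 by move=> /(dist_adj conn x); rewrite (dist1 xy).
rewrite -[#|nbrs e y|](cardsID B) (_ : nbrs e y :&: B = B); last first.
  by apply/setP=> z; rewrite !inE; case: (e y z).
rewrite addKn -[#|nbrs e y :\: B|](cardsID C) (_ : (nbrs e y :\: B) :&: C = C); last first.
  apply/setP=> z; rewrite !inE; case: (e y z) => //=.
  by case: eqP => //= ->.
rewrite addKn; apply: eq_card => z; rewrite !inE; case yz: (e y z) => /=; last by rewrite !andbF.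
rewrite !andbT -dist_eq1 //; have := d3 z yz.
by case: (dist e x z) => [|[|[|]]].
Qed.

Lemma drg_nonadj x y : x != y -> ~~ e x y -> #|nbrs e x :&: nbrs e y| <= c 2.
Proof.
move=> xy nxy; have [->|[w]] := set_0Vmem (nbrs e x :&: nbrs e y); first by rewrite cards0.
rewrite !inE => /andP[xw yw].
have d2 : dist e x y = 2.
  have := dist_adj conn x (etrans (e_sym w y) yw); rewrite (dist1 xw).
  have : dist e x y != 0 by rewrite dist_eq0.
  have : dist e x y != 1 by rewrite dist_eq1.
  by case: (dist e x y) => [|[|[|]]].
have := hc x y; rewrite d2 => <-; apply/subset_leq_card/subsetP=> z.
by rewrite !inE dist_eq1 // andbC.
Qed.

Lemma drg_pos : 2 <= diameter e -> (0 < b 0) && (0 < c 2).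
Proof.
case/(exists_dist2 conn)=> x [y xy]; have [z xz zy] := dist_pred conn xy.
rewrite -(drg_valency y) -xy -hc; apply/andP; split; apply/card_gt0P; exists z.
  by rewrite inE e_sym.
by rewrite inE e_sym zy xz xy.
Qed.

(** * Quadratic forms and eigenvalue bounds *)

Local Open Scope ring_scope.
Variable R : realType.
Local Notation A := (adjmx e R).
Local Notation n := #|T|.

Lemma sum_rank (F : 'I_n -> R) : \sum_i F i = \sum_(x : T) F (enum_rank x).
Proof. by rewrite (reindex (@enum_rank T)) //; apply: onW_bij; apply: enum_rank_bij. Qed.

Lemma adjmxE x y : A (enum_rank x) (enum_rank y) = (e x y)%:R.
Proof. by rewrite mxE !enum_rankK. Qed.

Definition row_fun (g : T -> R) : 'rV[R]_n := \row_i g (enum_val i).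

Lemma quad_row_fun (g : T -> R) (M : 'M[R]_n) :
  (row_fun g *m M *m (row_fun g)^T) 0 0 =
  \sum_x \sum_y g x * M (enum_rank x) (enum_rank y) * g y.
Proof.
rewrite mxE sum_rank exchange_big /=; apply: eq_bigr => y _.
rewrite !mxE sum_rank enum_rankK mulr_suml; apply: eq_bigr => x _.
by rewrite !mxE enum_rankK.
Qed.

Lemma sqr_row_fun (g : T -> R) :
  (row_fun g *m (row_fun g)^T) 0 0 = \sum_x g x ^+ 2.
Proof. by rewrite mxE sum_rank; apply: eq_bigr => x _; rewrite !mxE enum_rankK. Qed.

Lemma adjmx_sym : A^T = A.
Proof. by apply/matrixP=> i j; rewrite !mxE e_sym. Qed.

Lemma sum_delta (g : T -> R) x : \sum_y (y == x)%:R * g y = g x.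
Proof.
rewrite (bigD1 x) //= eqxx mul1r big1 ?addr0 // => y /negbTE->.
by rewrite mul0r.
Qed.

Lemma sum_nat_card (P : pred T) : \sum_y (P y)%:R = #|[set y | P y]|%:R :> R.
Proof. by rewrite -natr_sum -sum1dep_card [in RHS]big_mkcond. Qed.

(* Test vector: [theta] on the neighbours of [x], and at [x] the value [k] that
   then minimizes the quadratic form of [A - theta]. *)
Lemma valency_bound (x : T) (theta : R) : (0 < b 0)%N -> theta < 0 ->
  (forall mu, eigenvalue A mu -> theta <= mu) ->
  (b 0)%:R <= theta ^+ 2 - theta * (b 0 - b 1 - c 1)%:R.
Proof.
move=> k0 t0 hmin; set k : R := (b 0)%:R; set a1 : R := _%:R.
pose g y : R := k * (y == x)%:R + theta * (e x y)%:R.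
have gx : g x = k by rewrite /g eqxx e_irr /=; ring.
have gadj y : e x y -> g y = theta.
  move=> xy; rewrite /g xy (_ : y == x = false) /=; first by ring.
  by apply: contraTF xy => /eqP->; rewrite e_irr.
have sumg (h : T -> R) :
    \sum_y g y * h y = k * h x + theta * \sum_y (e x y)%:R * h y.
  rewrite -[in RHS](sum_delta h x) !mulr_sumr -big_split /=.
  by apply: eq_bigr => y _; rewrite /g; ring.
have sumn (t : R) : \sum_y (e x y)%:R * t = k * t.
  by rewrite -mulr_suml sum_nat_card drg_valency.
have sumA y : \sum_z (e y z)%:R * g z = k * (e y x)%:R + theta * #|nbrs e x :&: nbrs e y|%:R.
  under eq_bigr => z _ do rewrite mulrC.
  rewrite sumg; congr (_ + _ * _).
  under eq_bigr => z _ do rewrite -natrM mulnb.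
  by rewrite sum_nat_card; congr _%:R; apply: eq_card => z; rewrite !inE.
have := rayleigh (row_fun g) adjmx_sym hmin.
rewrite sqr_row_fun quad_row_fun.
under eq_bigr => y _ do rewrite expr2.
rewrite sumg gx (eq_bigr (fun y => (e x y)%:R * theta)); last first.
  by move=> y _; case xy: (e x y) => /=; [rewrite gadj | rewrite !mul0r].
rewrite sumn.
under [X in _ <= X]eq_bigr => y _.
  under eq_bigr => z _ do rewrite adjmxE -mulrA.
  rewrite -mulr_sumr sumA; over.
rewrite /= sumg e_irr setIid drg_valency -/k.
rewrite (eq_bigr (fun y => (e x y)%:R * (k + theta * a1))); last first.
  move=> y _; case xy: (e x y); last by rewrite /= !mul0r.
  by rewrite e_sym xy drg_adj //= mulr1.
rewrite sumn /= => h.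
have k0' : 0 < k by rewrite ltr0n.
have tk : theta * k < 0 by rewrite nmulr_rlt0.
(* [h] compares [theta * (k ^+ 2 + k * theta ^+ 2)] with [2 * k ^+ 2 * theta + theta ^+ 2 * k * a1];
   dividing by [theta * k < 0] reverses it. *)
rewrite -(ler_nM2l tk); lra.
Qed.

(** Neighbours of [y] are at distance [d.-1], [d] or [d.+1] from [x]. Charging [F d] to all and
    correcting the outer cases avoids [a_d]; for [d = 0] the first correction vanishes. *)
Lemma radial_sum (F : nat -> R) x y d : dist e x y = d ->
  \sum_z (e y z)%:R * F (dist e x z) =
  (b 0)%:R * F d + (c d)%:R * (F d.-1 - F d) + (b d)%:R * (F d.+1 - F d).
Proof.
move=> dE; rewrite -(drg_valency y) -dE -!hc -!hb dE.
rewrite -!sum_nat_card !mulr_suml -!big_split /=; apply: eq_bigr => z _.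
case yz: (e y z) => /=; last by ring.
have := dist_adj conn x yz; rewrite e_sym in yz; have := dist_adj conn x yz.
rewrite /= dE; case: (ltngtP (dist e x z) d) => [lt|lt|->].
- move=> h _; have -> : dist e x z = d.-1 by lia.
  rewrite eqxx (_ : d.-1 == d.+1 = false) /=; [ring | lia].
- move=> _ h; have -> : dist e x z = d.+1 by lia.
  rewrite eqxx (_ : d.+1 == d.-1 = false) /=; [ring | lia].
move=> _ _; rewrite (_ : d == d.+1 = false); last lia.
by case: eqP => [<-|_] /=; ring.
Qed.

(* For the idempotent [E] of [theta], the entries of [E] depend on the distance
   only, [E_xy = F (d(x,y))], so [k F 1 = theta F 0]; evaluating the
   semidefinite form [E] on the indicator of [C] gives the bound. *)
Lemma delsarte_bound (theta : R) (C : {set T}) : eigenvalue A theta ->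
  clique e C -> (0 < #|C|)%N -> (#|C|%:R - 1) * - theta <= (b 0)%:R.
Proof.
move=> /eigen_idempotent[E [E0 EA hE]] cC C0.
have [ET AE] : E^T = E /\ A *m E = E *m A.
  apply: (hE (fun M : 'M[R]_n => M^T = M /\ A *m M = M *m A)) => [|M [MT AM]|a M N [MT AM] [NT AN]].
  - by rewrite trmx1 mulmx1 mul1mx.
  - by split; rewrite ?trmx_mul ?adjmx_sym ?MT // mulmxA AM.
  - by rewrite linearD linearZ /= MT NT mulmxDr mulmxDl -scalemxAr -scalemxAl AM AN.
(* [A] acts on [E] as the scalar [theta], so every polynomial in [A], and [E] in particular, acts as
   a scalar. *)
have [q Eq] : exists q, E *m E = q *: E.
  apply: (hE (fun M : 'M[R]_n => exists q : R, M *m E = q *: E)).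
  - by exists 1; rewrite mul1mx scale1r.
  - move=> M [q ME]; exists (theta * q).
    by rewrite -mulmxA AE EA -scalemxAr ME scalerA.
  - move=> a M N [q ME] [r NE]; exists (a * q + r).
    by rewrite mulmxDl -scalemxAl ME NE scalerA scalerDl.
have [F FE] : exists F : nat -> R, forall x y,
    E (enum_rank x) (enum_rank y) = F (dist e x y).
  apply: (hE (fun M : 'M_n => exists F : nat -> R, forall x y,
    M (enum_rank x) (enum_rank y) = F (dist e x y))).
  - exists (fun d => (d == 0)%:R) => x y.
    by rewrite mxE (inj_eq enum_rank_inj) dist_eq0.
  - move=> M [F FE].
    exists (fun d => (b 0)%:R * F d + (c d)%:R * (F d.-1 - F d) + (b d)%:R * (F d.+1 - F d)).
    move=> x y; rewrite -(radial_sum F (erefl _)) mxE sum_rank; apply: eq_bigr => z _.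
    by rewrite adjmxE FE e_sym mulrC.
  - move=> a M N [F FE] [G GE]; exists (fun d => a * F d + G d) => x y.
    by rewrite !mxE FE GE.
have [x xC] := card_gt0P C0.
have kF : (b 0)%:R * F 1 = theta * F 0.
  have /matrixP/(_ (enum_rank x) (enum_rank x)) := EA.
  rewrite !mxE FE dist0 sum_rank => <-.
  rewrite -(drg_valency x) -sum_nat_card mulr_suml; apply: eq_bigr => z _.
  rewrite FE adjmxE (e_sym z x); case xz: (e x z); last by rewrite /= mul0r mulr0.
  by rewrite dist1 // mulrC.
(* This is a diagonal entry of [E *m E], the sum of squares of a nonzero row. The sign of [q] is not
   fixed, so the factor [q] is carried along. *)
have qF : 0 < q * F 0.
  have [y [z Eyz]] : exists y z, E (enum_rank y) (enum_rank z) != 0.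
    suff /existsP[y /existsP[z]] :
        [exists y, [exists z, E (enum_rank y) (enum_rank z) != 0]] by exists y, z.
    apply: contraNT E0 => /existsPn h; apply/eqP/matrixP=> i j; rewrite mxE.
    move: (h (enum_val i)) => /existsPn/(_ (enum_val j)).
    by rewrite !enum_valK negbK => /eqP.
  have /matrixP/(_ (enum_rank y) (enum_rank y)) := Eq.
  rewrite !mxE FE dist0 sum_rank => <-.
  have sq w : E (enum_rank y) (enum_rank w) * E (enum_rank w) (enum_rank y) =
      E (enum_rank y) (enum_rank w) ^+ 2.
    by rewrite -[in X in _ * X]ET mxE expr2.
  under eq_bigr => w _ do rewrite sq.
  rewrite (bigD1 z) //= ltr_wpDr ?sumr_ge0 // => [w _|]; first exact: sqr_ge0.
  by rewrite lt_def sqr_ge0 sqrf_eq0 Eyz.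
pose g y : R := (y \in C)%:R; pose t := (row_fun g *m E *m (row_fun g)^T) 0 0.
have tE : t = #|C|%:R * (F 0 + (#|C|%:R - 1) * F 1).
  rewrite /t quad_row_fun mulr_natl -sumr_const [RHS]big_mkcond /=.
  apply: eq_bigr => y _; rewrite /g; case yC: (y \in C); last first.
    by apply: big1 => z _; rewrite !mul0r.
  rewrite (bigD1 y) //= yC FE dist0 !mul1r mulr1; congr (_ + _).
  rewrite (cardsD1 y C) yC natrD [1 + _ - 1]addrAC subrr add0r.
  rewrite mulr_natl -sumr_const [RHS]big_mkcond [LHS]big_mkcond /=.
  apply: eq_bigr => z _; rewrite !inE FE; case: eqVneq => //= zy.
  case zC: (z \in C); rewrite ?mulr0 // !mul1r mulr1.
  by rewrite dist1 // cC // eq_sym.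
have qt : 0 <= q * t.
  have -> : q * t = (row_fun g *m E *m (row_fun g *m E)^T) 0 0.
    by rewrite trmx_mul ET mulmxA -(mulmxA _ E E) Eq -scalemxAr -scalemxAl mxE.
  set w := row_fun g *m E; rewrite mxE; apply: sumr_ge0 => i _.
  by rewrite [w^T _ _]mxE -expr2 sqr_ge0.
have c0 : 0 < #|C|%:R :> R by rewrite ltr0n.
(* The factor [b 0] lets [kF] eliminate [F 1]. *)
have : 0 <= (b 0)%:R * (q * t) by rewrite mulr_ge0.
rewrite tE (_ : _ * _ = (q * F 0) * #|C|%:R * ((b 0)%:R + (#|C|%:R - 1) * theta)); last first.
  transitivity (q * #|C|%:R * ((b 0)%:R * F 0 + (#|C|%:R - 1) * ((b 0)%:R * F 1))); first by ring.
  by rewrite kF; ring.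
rewrite (pmulr_rge0 _ (mulr_gt0 qF c0)); lra.
Qed.
End DistanceRegular.

(** * Lines as Delsarte cliques *)

Local Open Scope ring_scope.

Theorem theorem5p3 (R : realType) (m : nat) (T : finType) (e : rel T)
    (b c : nat -> nat) (theta : R) :
  (2 <= m)%N ->
  distance_regular e b c ->
  (2 <= diameter e)%N ->
  smallest_eigenvalue e theta ->
  - (m%:R) <= theta -> theta < 1 - m%:R ->
  (m ^ 2 * c 2 < b 0 - b 1 - c 1)%N ->
  geometric e (b 0%N) theta /\ theta = - (m%:R).
Proof.
move=> m2 drg D2 [theta_ev theta_min] theta_ge theta_lt a1_gt.
have [[e_sym e_irr] conn _] := drg.
have [x0 [y0 d2]] := exists_dist2 conn D2.
have /andP[k0 c0] := drg_pos drg D2.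
have adj := drg_adj drg; have nonadj := drg_nonadj drg; have val := drg_valency drg.
set k := b 0 in k0 val *; set lam := (_ - _ - _)%N in adj a1_gt.
have {m2} [s s0 mE] : exists2 s, (0 < s)%N & m = s.+1.
  by exists m.-1; lia.
have [nu nuE] : exists nu, c 2 = nu.+1 by exists (c 2).-1; rewrite prednK.
rewrite nuE in a1_gt nonadj; subst m.
have sR : 1 <= s%:R :> R by rewrite ler1n.
have theta_neg : theta < 0 by move: theta_lt; rewrite -natr1; lra.
(* The right-hand side of [valency_bound] grows with [- theta], which is at most [s.+1]. *)
have k_le : (k <= s.+1 * lam + s.+1 ^ 2)%N.
  rewrite -(ler_nat R) natrD natrM natrX.
  apply: le_trans (valency_bound drg x0 k0 theta_neg theta_min) _.
  rewrite -/k -/lam; have : 0 <= lam%:R :> R by [].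
  move: theta_ge; nra.
have lam_large : (s.*2.+1 * nu <= lam)%N by nia.
(* By [k_le] and the binomial estimate the left side is at most [s.+1 * lam + s.+1 ^ 2 * nu.+1], and
   [s.+1 ^ 2 * nu.+1 < lam]. *)
have k_small : (k + 'C(s.+2, 2) * nu < s.+2 * lam.+1)%N.
  have : ('C(s.+2, 2) <= s.+1 ^ 2)%N by rewrite bin2 /= -(leq_pmul2l (ltn0Sn 1)); lia.
  nia.
pose CC := [set L | line e lam nu s L].
have lineP L : L \in CC -> [/\ clique e L, (1 < #|L|)%N & (s.+1 < #|L|)%N].
  rewrite inE => lL; split; last 2 first.
  - exact: line_card_ge2 lL.
  - case/andP: lL => _; nia.
  by case/andP: lL => /maxsetP[/cliqueP].
have uniqL L1 L2 x y : L1 \in CC -> L2 \in CC -> e x y ->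
    x \in L1 -> y \in L1 -> x \in L2 -> y \in L2 -> L1 = L2.
  by rewrite !inE => l1 l2; apply: (line_unique e_sym e_irr adj nonadj lam_large).
have pairs x y : x != y -> #|[set L in CC | (x \in L) && (y \in L)]| = e x y.
  move=> xy; case exy: (e x y) => /=.
    have [L [lL xL yL]] := edge_in_line e_sym e_irr adj nonadj lam_large val k_small exy.
    apply/eqP/cards1P; exists L; apply/setP=> M; rewrite in_set1 !in_set.
    apply/idP/eqP => [/and3P[lM xM yM]|->]; last by rewrite lL xL.
    by apply: uniqL exy _ _ _ _ => //; rewrite inE.
  apply/eqP; rewrite cards_eq0; apply/eqP/setP=> L; rewrite !in_set0 in_set.
  apply/negbTE/negP=> /and3P[/lineP[cL _ _] xL yL].
  by rewrite cL in exy.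
have edge x y : e x y -> #|[set L in CC | (x \in L) && (y \in L)]| = 1%N.
  by move=> exy; rewrite pairs ?exy //; apply: contraTneq exy => ->; rewrite e_irr.
have clCC : {in CC, forall L : {set T}, clique e L} by move=> L /lineP[].
have sumk x := sum_card_blocks e_irr clCC edge val x.
have dels L : L \in CC -> (#|L|%:R - 1) * - theta <= k%:R.
  by case/lineP=> cL L1 _; apply: (delsarte_bound drg theta_ev cL (ltnW L1)).
have sumR x : \sum_(L in CC | x \in L) (#|L|%:R - 1) = k%:R :> R.
  rewrite -(sumk x) natr_sum; apply: eq_bigr => L /andP[_ xL].
  by rewrite (cardsD1 x L) xL natrD addrAC subrr add0r.
have points x : #|[set L in CC | x \in L]| = s.+1.
  apply/eqP; rewrite eqn_leq; apply/andP; split.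
    have := card_lines_through e_sym e_irr adj nonadj lam_large val k_small x.
    by congr (_ <= _)%N; apply: eq_card => L; rewrite !inE.
  (* Summing the Delsarte bound over the lines on [x] shows that they number at least [- theta],
     which exceeds [s]. *)
  have : k%:R * - theta <= k%:R * #|[set L in CC | x \in L]|%:R.
    rewrite -{1}(sumR x) mulr_suml mulr_natr -sumr_const.
    rewrite [leRHS](eq_bigl (fun L => (L \in CC) && (x \in L))); last by move=> L; rewrite inE.
    by apply: ler_sum => L /andP[/dels].
  rewrite ler_pM2l ?ltr0n // => h.
  rewrite -(ltr_nat R); apply: lt_le_trans h.
  by move: theta_lt; rewrite -natr1; lra.
have nT : (0 < #|T|)%N by apply/card_gt0P; exists x0.
(* Incidences: [s.+1] lines on each vertex, at least [s.+2] vertices on each line. *)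
have ltCC : (#|CC| < #|T|)%N.
  have : (\sum_(L in CC) #|L| = #|T| * s.+1)%N.
    under eq_bigr => L _ do rewrite -sum1_card big_mkcond.
    rewrite exchange_big /= -sum_nat_const; apply: eq_bigr => x _.
    by rewrite -(points x) -sum1dep_card -big_mkcondr.
  have : (#|CC| * s.+2 <= \sum_(L in CC) #|L|)%N.
    by rewrite -sum_nat_const; apply: leq_sum => L /lineP[].
  nia.
have thetaE : theta = - s.+1%:R.
  apply/eqP; rewrite eq_le theta_ge andbT; apply: theta_min.
  exact: linear_space_eigenvalue e_irr pairs points ltCC.
split=> //; split.
  move=> /(_ x0 y0); rewrite -(dist_eq0 conn) -(dist_eq1 conn e_irr) d2.
  by move=> /(_ isT).
exists CC; split=> [L LC|x y xy].
  have [cL L1 _] := lineP L LC; split=> //.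
  have [x xL] := card_gt0P (ltnW L1).
  (* With exactly [s.+1] lines on [x] and [theta = - s.+1], the nonnegative slacks in the Delsarte
     bound sum to zero, so each vanishes. *)
  have : \sum_(M in CC | x \in M) (k%:R - (#|M|%:R - 1) * - theta) = 0.
    rewrite sumrB -mulr_suml sumR thetaE opprK -(points x) mulr_natr -sumr_const.
    by rewrite [X in _ - X](eq_bigl (fun M => (M \in CC) && (x \in M))) ?subrr // => M; rewrite inE.
  move/eqP; rewrite psumr_eq0 => [/allP/(_ L)|M /andP[/dels]]; last by rewrite subr_ge0.
  rewrite mem_index_enum LC xL => /(_ isT)/eqP h.
  have t0 : - theta != 0 by rewrite oppr_eq0 lt_eqF.
  apply: (mulIf t0); rewrite mulrDl divfK //; lra.
have /eqP/cards1P[L /setP LE] := edge x y xy.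
exists L; split.
  by have := LE L; rewrite set11 in_set => /and3P[-> -> ->].
move=> M [MC [xM yM]]; have := LE M; rewrite in_set MC xM yM in_set1 => h.
by apply/eqP; rewrite eq_sym -h.
Qed.
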